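(* Let $(\alpha,\beta)\in\mathbb{C}^2$ with $|\alpha|>1$ and $|\beta|>1$. Assume that $2\leq \mu\left(\frac{\log|\alpha|}{\log|\beta|}\right)<\infty$, where $\mu$ denotes the irrationality exponent. Then $$T_{\alpha,\beta}(x)=\frac{(\log x)^2}{\log|\alpha|\,\log|\beta|}+O(\log x\cdot\log\log x)$$ for $x$ large enough, where $T_{\alpha,\beta}(x)=\#\{(n,m)\in\mathbb{N}^2 : |\alpha^n-\beta^m|\leq x\}$.
   Context: $\mathbb{N}$ denotes the positive integers. For a real number $\xi$, the irrationality exponent is $$\mu(\xi)=\sup\left\{\mu : 0<\left|\xi-\frac{p}{q}\right|<\frac{1}{q^{\mu}}\text{ has infinitely many solutions }(p,q)\in\mathbb{Z}\times\mathbb{N}\right\}.$$ It equals $1$ for rational $\xi$, $\infty$ for Liouville numbers, and lies in $[2,\infty)$ for all other real numbers. The $O$-constant refers to $x\to\infty$ and may depend on $\alpha,\beta$. *)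

(* Defs.v *)
From HB Require Import structures.
From mathcomp Require Export all_boot all_order all_algebra.
From mathcomp Require Export all_classical all_reals all_analysis.
From mathcomp Require Import finmap.
From mathcomp.real_closed Require Export complex.

Set Implicit Arguments.
Unset Strict Implicit.
Unset Printing Implicit Defensive.

Import Order.TTheory GRing.Theory Num.Theory.
Import numFieldNormedType.Exports.

Local Open Scope classical_set_scope.
Local Open Scope ring_scope.

(* The pair [pq] stands for the fraction [pq.1 / pq.2] with positive
   denominator; [(p, q)] is not required to be in lowest terms. *)
Definition approximations (R : realType) (xi nu : R) : set (int * nat) :=
  [set pq | (0 < pq.2)%N
     /\ 0 < `|xi - pq.1%:~R / pq.2%:R| < 1 / (pq.2%:R `^ nu)].

Definition irrationality_exponent (R : realType) (xi : R) : \bar R :=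
  ereal_sup [set nu%:E | nu in [set nu : R | infinite_set (approximations xi nu)]].

(* [Normc.normc z : R] is the real-valued modulus; the generic norm
   [`|z|] takes its values in [R[i]]. *)
Definition close_powers (R : realType) (alpha beta : R[i]) (x : R) :
    set (nat * nat) :=
  [set nm | [/\ (0 < nm.1)%N, (0 < nm.2)%N
      & Normc.normc (alpha ^+ nm.1 - beta ^+ nm.2) <= x]].

(* [fset_set] sends an infinite set to the empty one, so this is the number of
   elements of [close_powers alpha beta x] only when that set is finite. *)
Definition count_close_powers (R : realType) (alpha beta : R[i]) (x : R) : nat :=
  #|` fset_set (close_powers alpha beta x)|%fset.

(* Lets the Landau notations be used at [+oo]. *)
Canonical pinfty_filter_on (R : numFieldType) :=
  FilterType (pinfty_nbhs R) (@filter_filter R _ proper_pinfty_nbhs).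

(* Main.v *)
(* Write a = log |alpha|, b = log |beta|.  An exponent in [2, +oo[ makes a / b
   irrational with |n a - m b| >= c / n^k.  Since
   2 | |alpha|^n - |beta|^m | >= exp (max (n a, m b)) min (1, |n a - m b|),
   a pair counted at x satisfies max (n a, m b) <= log x + k log n + C, whence
   n = O(log x), and feeding this back, n a and m b are at most
   log x + D log log x.  Conversely n a, m b <= log x - 1 suffices, so the
   count lies between the numbers of lattice points of two rectangles. *)
Require Import Defs.
From mathcomp Require Import finmap ring lra.

Import Order.TTheory GRing.Theory Num.Theory.
Import numFieldNormedType.Exports.

Local Open Scope classical_set_scope.
Local Open Scope ring_scope.

(** * Cardinalities of finite sets and boxes of lattice points *)

Lemma finite_set_seq (T : choiceType) (s : seq T) : finite_set [set` s].
Proof. by apply/finite_seqP; exists s. Qed.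

Lemma card_fset_set_le (T : choiceType) (A : set T) (s : seq T) :
  A `<=` [set` s] -> (#|` fset_set A|%fset <= size s)%N.
Proof.
move=> As; have fA : finite_set A by apply: (sub_finite_set As); exact: finite_set_seq.
apply: leq_trans (size_undup s); rewrite -card_fseq; apply: fsubset_leq_card.
apply/fsubsetP => x; rewrite in_fset_set// => /set_mem Ax; have /= xs := As _ Ax.
by rewrite in_fset.
Qed.

(** Since [fset_set] is empty on infinite sets, finiteness must be known beforehand; with [uniq s]
    the length of [s] counts its elements. *)
Lemma card_fset_set_ge (T : choiceType) (A : set T) (s : seq T) :
  finite_set A -> uniq s -> [set` s] `<=` A ->
  (size s <= #|` fset_set A|%fset)%N.
Proof.
move=> fA us sA; rewrite -(undup_id us) -card_fseq; apply: fsubset_leq_card.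
apply/fsubsetP => x; rewrite in_fset => xs.
by rewrite in_fset_set//; apply/mem_set/sA.
Qed.

Definition box (N M : nat) : seq (nat * nat) :=
  [seq (n, m) | n <- iota 1 N, m <- iota 1 M].

Lemma mem_box (N M : nat) (p : nat * nat) :
  (p \in box N M) = ((0 < p.1 <= N) && (0 < p.2 <= M))%N.
Proof.
case: p => n m; rewrite -[RHS]/((1 <= n < 1 + N) && (1 <= m < 1 + M))%N -!mem_iota.
by apply/allpairsP/andP => [[[i j] /= [? ? [-> ->]]] //|[? ?]]; exists (n, m).
Qed.

Lemma size_box (N M : nat) : size (box N M) = (N * M)%N.
Proof. by rewrite size_allpairs !size_iota. Qed.

Lemma uniq_box (N M : nat) : uniq (box N M).
Proof. by apply: allpairs_uniq; rewrite ?iota_uniq// => -[? ?] [? ?]. Qed.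

(** * Diophantine approximation of a real number *)

Lemma finite_set_int_norm_le (k : nat) : finite_set [set p : int | (`|p| <= k)%N].
Proof.
apply: (@sub_finite_set _ _ (Posz @` `I_k.+1 `|` Negz @` `I_k)).
  by case=> n /= nk; [left|right]; exists n.
by rewrite finite_setU; split; apply: finite_image; apply: finite_II.
Qed.

(** Take the least positive value of [f] on [s], capped at 1; the cap also serves when there is
    none. *)
Lemma seq_pos_lower_bound (R : realType) (T : eqType) (f : T -> R) (s : seq T) :
  exists c, 0 < c <= 1 /\ {in s, forall x, 0 < f x -> c <= f x}.
Proof.
elim: s => [|x s [c [/andP[c0 c1] cs]]]; first by exists 1; split => //; rewrite ltr01 lexx.
have [fx0|fx0] := ltP 0 (f x); last first.
  exists c; split; rewrite ?c0// => y; rewrite inE => /predU1P[->|/cs//].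
  by rewrite ltNge fx0.
exists (Num.min c (f x)); split.
  by rewrite lt_min c0 fx0 ge_min c1.
move=> y; rewrite inE => /predU1P[->|ys] fy; first by rewrite ge_min lexx orbT.
by rewrite ge_min cs.
Qed.

(** Distinct fractions p0/q0 and p/q are at least 1/(q0 q) apart, so being closer than 1/q^nu forces
    q^(nu-1) < q0. This bounds q, and then p. *)
Lemma finite_approximations_rat (R : realType) (p0 : int) (q0 : nat) (nu : R) :
  (0 < q0)%N -> 1 < nu -> finite_set (approximations (p0%:~R / q0%:R) nu).
Proof.
move=> q0gt0 nu1; set xi : R := _ / _.
have Q0 : 0 < q0%:R :> R by rewrite ltr0n.
pose K := (Num.truncn (q0%:R `^ (nu - 1)^-1 : R)).+1.
(* The numerator is p = (xi - d) q, where d = xi - p/q has |d| <= 1 and q < [K]. *)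
pose K' := (Num.truncn ((`|xi| + 1) * K%:R)).+1.
apply: (@sub_finite_set _ _ ([set p : int | (`|p| <= K')%N] `*` `I_K)); last first.
  by apply: finite_setX; [exact: finite_set_int_norm_le|exact: finite_II].
case=> p q [/= qgt0 /andP[d0 d1]].
have Q : 0 < q%:R :> R by rewrite ltr0n.
have Q1 : 1 <= q%:R :> R by rewrite ler1n.
have qK : q%:R < K%:R :> R.
  have dE : (xi - p%:~R / q%:R) * (q0%:R * q%:R) = (p0 * q - p * q0)%:~R.
    rewrite rmorphB !rmorphM /= /xi -!pmulrn; field.
    by rewrite !gt_eqF.
  have : 1 <= `|xi - p%:~R / q%:R| * (q0%:R * q%:R).
    rewrite -[X in _ * X]ger0_norm ?mulr_ge0 ?ler0n// -normrM dE -intr_norm.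
    rewrite ler1z -gtz0_ge1 normr_gt0 -(intr_eq0 R) -dE.
    by rewrite mulf_neq0 ?(gt_eqF (mulr_gt0 Q0 Q))// -normr_gt0.
  have pow0 : 0 < q%:R `^ (nu - 1) :> R by rewrite powR_gt0.
  have powE : q%:R `^ nu = q%:R `^ (nu - 1) * q%:R :> R.
    by rewrite -[X in _ * X](powRr1 (ltW Q)) -powRD ?subrK// (gt_eqF Q) implybT.
  move: d1; rewrite powE ltr_pdivlMr ?mulr_gt0// => d1 d2.
  have {}d1 : q%:R `^ (nu - 1) < q0%:R :> R.
    rewrite -(ltr_pM2l d0); rewrite -(ltr_pM2r Q); nra.
  have nu0 : 0 < (nu - 1)^-1 by rewrite invr_gt0 subr_gt0.
  have : q%:R < q0%:R `^ (nu - 1)^-1 :> R.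
    have {1}-> : q%:R = (q%:R `^ (nu - 1)) `^ (nu - 1)^-1 :> R.
      by rewrite -powRrM divff ?powRr1 ?ltW// subr_eq0 gt_eqF.
    by rewrite gt0_ltr_powR// nnegrE ltW.
  by move=> /lt_trans; apply; apply: truncnS_gt.
split => /=; last by rewrite -(ltr_nat R).
rewrite -(ler_nat R) natr_absz intr_norm; apply: (le_trans _ (ltW (truncnS_gt _))).
have d2 : `|xi - p%:~R / q%:R| <= 1.
  apply: le_trans (ltW d1) _; rewrite div1r invf_le1 ?powR_gt0//.
  by rewrite -[X in X <= _](powRr0 q%:R) ler_powR// ltW// (lt_trans ltr01).
have -> : p%:~R = (xi - (xi - p%:~R / q%:R)) * q%:R :> R.
  by rewrite opprB addrC subrK divfK// gt_eqF.
rewrite normrM; apply: ler_pM => //; last by rewrite ger0_norm ltW.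
by apply: le_trans (ler_normB _ _) _; rewrite lerD2l.
Qed.

(* The constant absorbs the finitely many approximations of exponent k, for some
   integer k above the irrationality exponent. *)
Lemma irrationality_measure (R : realType) (xi : R) :
  (2%:E <= irrationality_exponent xi < +oo)%E ->
  exists c k, 0 < c <= 1 /\ forall (p : int) (q : nat), (0 < q)%N ->
    c / q%:R ^+ k <= `|xi - p%:~R / q%:R|.
Proof.
move=> /andP[mu2 muoo].
(* A rational [xi] would have only finitely many approximations for each exponent above 1, against
   an irrationality exponent of at least 2. *)
have irr (p : int) (q : nat) : (0 < q)%N -> 0 < `|xi - p%:~R / q%:R|.
  move=> q0; rewrite normr_gt0 subr_eq0; apply/eqP => xiE.
  have /ereal_sup_gt[_ [nu nuinf <-]] : (1%:E < irrationality_exponent xi)%E.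
    by apply: lt_le_trans mu2; rewrite lte_fin ltr1n.
  rewrite lte_fin => nu1; apply: nuinf.
  by rewrite xiE; exact: finite_approximations_rat.
have [k fk] : exists k : nat, finite_set (approximations xi k%:R).
  (* Otherwise every natural number is at most the irrationality exponent, which is then neither
     finite nor -oo. *)
  apply: contrapT => /forallNP H.
  have ub k : (k%:R%:E <= irrationality_exponent xi)%E.
    by apply: ereal_sup_ubound; exists k%:R => //; exact: H.
  case: (irrationality_exponent xi) muoo ub => [r _|//|_] ub.
    by have := ub ((Num.truncn r).+1); rewrite lee_fin leNgt truncnS_gt.
  by have := ub 0%N.
have /finite_seqP[s sE] := fk.
have [c [c01 cs]] :=
  seq_pos_lower_bound R _ (fun pq : int * nat => `|xi - pq.1%:~R / pq.2%:R|) s.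
exists c, k; split=> // p q q0.
have /andP[c0 c1] := c01.
have Qk : 1 <= q%:R ^+ k :> R by rewrite exprn_ege1// ler1n.
have Qk0 := lt_le_trans ltr01 Qk.
(* A listed fraction is at distance at least c; any other is at distance at least 1/q^k. Both are at
   least c/q^k. *)
have [|] := pselect (approximations xi k%:R (p, q)).
  rewrite sE => /cs /(_ (irr _ _ q0)) /=; apply: le_trans.
  by rewrite ler_pdivrMr// ler_peMr// ltW.
move=> napp; rewrite leNgt; apply/negP => lt; apply: napp.
split => //=; rewrite irr//= powR_mulrn ?ler0n//.
by apply: lt_le_trans lt _; rewrite ler_pM2r ?invr_gt0.
Qed.

(** * Inequalities for exponentials, moduli and logarithms *)

(** For t = u - v >= 0, e^t >= 1 + t gives e^u - e^v >= e^u t/(1 + t), and 2t/(1 + t) >= min(1,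
    t). *)
Lemma expR_dist_ge (R : realType) (u v : R) :
  expR (Num.max u v) * Num.min 1 `|u - v| <= 2 * `|expR u - expR v|.
Proof.
wlog vu : u v / v <= u.
  move=> H; have /orP[/H//|/H] := le_total v u.
  by rewrite maxC (distrC v) (distrC (expR v)).
rewrite max_l// !ger0_norm ?subr_ge0 ?ler_expR//.
set t := u - v; have t0 : 0 <= t by rewrite subr_ge0.
have E0 := expR_gt0 u; have F0 := expR_gt0 v.
have EF : expR v * (1 + t) <= expR u.
  have -> : u = v + t by rewrite /t addrC subrK.
  by rewrite expRD ler_wpM2l ?expR_ge1Dx ?(ltW F0).
have [t1|t1] := leP 1 t; first nra.
rewrite -(@ler_pM2r _ (1 + t)); last lra.
have : 0 <= expR u * t * (1 - t).
  by apply: mulr_ge0; [apply: mulr_ge0|]; lra.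
lra.
Qed.

Lemma normcX (R : realType) (z : R[i]) (n : nat) :
  Normc.normc (z ^+ n) = Normc.normc z ^+ n.
Proof.
by elim: n => [|n IHn]; rewrite ?expr0 ?Normc.normc1// !exprS Normc.normcM IHn.
Qed.

Lemma dist_normc (R : realType) (z w : R[i]) :
  `|Normc.normc z - Normc.normc w| <= Normc.normc (z - w).
Proof.
have H (s t : R[i]) : Normc.normc s - Normc.normc t <= Normc.normc (s - t).
  rewrite lerBlDr -{1}(subrK t s);
  exact: le_normcD.
rewrite ler_norml H andbT lerNl opprB -(opprB w) normcN; exact: H.
Qed.

Lemma exprn_expR_ln (R : realType) (r : R) (n : nat) :
  0 < r -> r ^+ n = expR (n%:R * ln r).
Proof. by move=> r0; rewrite expRM_natl lnK. Qed.

(* The hypothesis first gives the crude bound n = O(y), because log n is at most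
   a small multiple of n; then log n = log y + O(1). *)
Lemma log_absorb (R : realType) (a C k : R) : 0 < a -> 0 <= k -> exists D, 0 <= D /\
  forall y n : R, expR 1 <= y -> 1 <= n -> n * a <= y + k * ln n + C ->
    y + k * ln n + C <= y + D * ln y.
Proof.
move=> a0 k0.
(* Chosen so that k e <= a/2: then log n <= e n - log e leaves n a/2 <= [P] y, where [P] collects
   the constants. Using k + 1 avoids division by zero. *)
pose e := a / (2 * (k + 1)).
have e0 : 0 < e by rewrite divr_gt0// mulr_gt0// ltr_wpDl.
pose P := 1 + `|C| + k * `|ln e|.
have P0 : 1 <= P by rewrite /P -addrA lerDl addr_ge0// mulr_ge0.
have Pa0 : 0 < 2 * P / a by rewrite divr_gt0// mulr_gt0// (lt_le_trans ltr01).
(* From n <= (2P/a) y one gets log n <= log(2P/a) + log y; constants are absorbed by log y >= 1. *)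
exists (k * (`|ln (2 * P / a)| + 1) + `|C|); split.
  by rewrite addr_ge0// mulr_ge0// addr_ge0.
move=> y n ye n1 nay.
have y1 : 1 <= y by apply: le_trans ye; rewrite -expR0 ler_expR.
have y0 := lt_le_trans ltr01 y1.
have n0 := lt_le_trans ltr01 n1.
have z1 : 1 <= ln y by rewrite -[X in X <= _]expRK ler_ln ?posrE ?expR_gt0.
have lnn : ln n <= e * n - ln e.
  rewrite lerBrDl -lnM ?posrE//.
  by apply: ltW; apply: ln_sublinear; rewrite mulr_gt0.
have ek : k * e <= a / 2.
  rewrite /e; have -> : k * (a / (2 * (k + 1))) = a / 2 * (k / (k + 1)).
    by field; rewrite gt_eqF// ltr_wpDl.
  rewrite ler_piMr ?divr_ge0 ?ltW// ltr_pdivrMr ?ltr_wpDl//; lra.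
have nP : n <= 2 * P / a * y.
  rewrite mulrAC ler_pdivlMr// -mulrA (mulrC 2) -ler_pdivrMr//.
  have h1 := ler_wpM2l k0 lnn.
  have h2 : k * e * n <= a / 2 * n by rewrite ler_pM2r.
  have h3 : k * - ln e <= k * `|ln e| by rewrite ler_wpM2l// -normrN ler_norm.
  have h4 : 0 <= (`|C| + k * `|ln e|) * (y - 1).
    by rewrite mulr_ge0 ?subr_ge0// addr_ge0// mulr_ge0.
  have h5 := ler_norm C.
  rewrite /P; lra.
have lnnD : ln n <= (`|ln (2 * P / a)| + 1) * ln y.
  apply: (@le_trans _ _ (ln (2 * P / a) + ln y)).
    by rewrite -lnM ?posrE// ler_ln ?posrE// mulr_gt0.
  rewrite [X in _ <= X]mulrDl mul1r lerD2r; apply: le_trans (ler_norm _) _.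
  by rewrite ler_peMr.
have : C <= `|C| * ln y by apply: le_trans (ler_norm _) _; rewrite ler_peMr.
have := ler_wpM2l k0 lnnD; lra.
Qed.

(** * Linear forms in two logarithms and the size of close powers *)

(** Factor n a - m b = (a/b - m/n) b n and drop n >= 1. The cap at 1 lets the minimum in
    [expR_dist_ge] be bounded by the same quantity. *)
Lemma linear_form_lower_bound (R : realType) (a b : R) : 0 < a -> 0 < b ->
  (2%:E <= irrationality_exponent (a / b) < +oo)%E ->
  exists c k, 0 < c <= 1 /\ forall n m : nat, (0 < n)%N ->
    c / n%:R ^+ k <= `|n%:R * a - m%:R * b|.
Proof.
move=> a0 b0 /irrationality_measure[c [k [/andP[c0 c1] ck]]].
exists (Num.min 1 (c * b)), k; split.
  by rewrite lt_min ltr01 mulr_gt0// ge_min lexx.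
move=> n m n0.
have N1 : 1 <= n%:R :> R by rewrite ler1n.
have N0 := lt_le_trans ltr01 N1.
have NE : n%:R * a - m%:R * b = (a / b - (m%:Z)%:~R / n%:R) * (b * n%:R).
  by rewrite -pmulrn; field; rewrite !gt_eqF.
rewrite NE normrM [X in _ <= _ * X]gtr0_norm ?mulr_gt0//.
apply: (@le_trans _ _ (c / n%:R ^+ k * (b * n%:R))); last first.
  by rewrite ler_pM2r ?mulr_gt0//; exact: ck.
rewrite [X in _ <= X]mulrAC ler_pM2r ?invr_gt0 ?exprn_gt0//.
by rewrite ge_min mulrA [X in _ || X]ler_peMr ?orbT// mulr_ge0// ltW.
Qed.

(** With u = n a and v = m b, e^max(u, v) c/n^k <= 2 |e^u - e^v| <= 2x. Taking logarithms gives the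
    hypothesis of [log_absorb] at y = log x, and x >= e^e gives y >= e. *)
Lemma close_powers_log_bound (R : realType) (alpha beta : R[i]) :
  let a := ln (Normc.normc alpha) in let b := ln (Normc.normc beta) in
  0 < a -> 0 < b ->
  (2%:E <= irrationality_exponent (a / b) < +oo)%E ->
  exists D, 0 <= D /\ forall x, expR (expR 1) <= x ->
    forall p, close_powers alpha beta x p ->
      Num.max (p.1%:R * a) (p.2%:R * b) <= ln x + D * ln (ln x).
Proof.
move=> a b a0 b0 /(linear_form_lower_bound R _ _ a0 b0)[c [k [/andP[c0 c1] ck]]].
have [D [D0 HD]] := log_absorb R a (ln (2 / c)) k%:R a0 (ler0n _ _).
exists D; split => // x xe [n m] [/= n0 m0 nmx].
have x0 : 0 < x by apply: lt_le_trans xe; exact: expR_gt0.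
have N1 : 1 <= n%:R :> R by rewrite ler1n.
have Nk1 : 1 <= n%:R ^+ k :> R by rewrite exprn_ege1.
have Nk0 := lt_le_trans ltr01 Nk1.
(* [ln] takes the value 0 on nonpositive reals, so a positive logarithm forces a positive
   modulus. *)
have normc_gt0 (z : R[i]) : 0 < ln (Normc.normc z) -> 0 < Normc.normc z.
  by move=> z0; rewrite ltNge; apply/negP => /ln0 zE; rewrite zE ltxx in z0.
have maxle : Num.max (n%:R * a) (m%:R * b) <= ln x + k%:R * ln n%:R + ln (2 / c).
  have -> : ln x + k%:R * ln n%:R + ln (2 / c) = ln (x * n%:R ^+ k * (2 / c)).
    rewrite [RHS]lnM ?posrE ?divr_gt0 ?(mulr_gt0 x0 Nk0)//
      [ln (x * _)]lnM ?posrE// lnXn ?mulr_natl//;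
      last exact: lt_le_trans N1.
  rewrite -[X in X <= _]expRK ler_ln ?posrE ?expR_gt0//; last first.
    by rewrite mulr_gt0 ?divr_gt0// mulr_gt0.
  have -> : x * n%:R ^+ k * (2 / c) = 2 * x / (c / n%:R ^+ k) by field; rewrite !gt_eqF.
  rewrite ler_pdivlMr ?divr_gt0//.
  apply: le_trans (le_trans (expR_dist_ge _ (n%:R * a) (m%:R * b)) _).
    rewrite ler_pM2l ?expR_gt0// le_min ck// andbT ler_pdivrMr// mul1r.
    exact: le_trans Nk1.
  rewrite ler_pM2l// -!exprn_expR_ln ?normc_gt0// -!normcX.
  exact: le_trans (dist_normc _ _ _) nmx.
apply: (le_trans maxle); apply: (HD _ n%:R) => //.
  by rewrite -[X in X <= _]expRK ler_ln ?posrE ?expR_gt0.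
by apply: le_trans maxle; rewrite le_max lexx.
Qed.

(** * The asymptotic count *)

Theorem theorem1 (R : realType) (alpha beta : R[i]) :
  1 < Normc.normc alpha -> 1 < Normc.normc beta ->
  (2%:E <= irrationality_exponent
             (ln (Normc.normc alpha) / ln (Normc.normc beta)) < +oo)%E ->
  (forall x : R, finite_set (close_powers alpha beta x)) /\
  (fun x : R => (count_close_powers alpha beta x)%:R : R)
    = (fun x : R =>
         ln x ^+ 2 / (ln (Normc.normc alpha) * ln (Normc.normc beta)))
      +O_ (+oo_R) (fun x : R => ln x * ln (ln x)).
Proof.
move=> alpha1 beta1.
have a0 := ln_gt0 alpha1; have b0 := ln_gt0 beta1.
move=> /(close_powers_log_bound _ _ _ a0 b0)[].
set a := ln (Normc.normc alpha) in a0 *; set b := ln (Normc.normc beta) in b0 *.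
move=> D [D0 HD].
pose U (x : R) := ln x + D * ln (ln x).
have lnx_ge (x : R) : expR (expR 1) <= x -> expR 1 <= ln x.
  move=> xe; rewrite -[X in X <= _]expRK ler_ln ?posrE ?expR_gt0//.
  by apply: lt_le_trans xe; exact: expR_gt0.
have lnlnx_ge (x : R) : expR (expR 1) <= x -> 1 <= ln (ln x).
  move=> /lnx_ge xe; rewrite -[X in X <= _]expRK ler_ln ?posrE ?expR_gt0//.
  by apply: lt_le_trans xe; exact: expR_gt0.
have e2 : 2 <= expR 1 :> R by have := expR_ge1Dx (1 : R); lra.
have U0 (x : R) : expR (expR 1) <= x -> 0 <= U x.
  move=> xe; have := lnx_ge x xe; have := lnlnx_ge x xe => z1 y1.
  by rewrite addr_ge0 ?mulr_ge0//; lra.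
have sub_box (x : R) : expR (expR 1) <= x -> close_powers alpha beta x `<=`
    [set` box (Num.truncn (U x / a)) (Num.truncn (U x / b))].
  move=> xe p xp; have := HD x xe p xp; case: xp => p1 p2 _.
  rewrite ge_max => /andP[pa pb] /=; rewrite mem_box p1 p2 /=.
  by rewrite !truncn_ge_nat ?divr_ge0 ?U0// ?(ltW a0) ?(ltW b0)// !ler_pdivlMr// pa pb.
(* Small x are covered by monotonicity: enlarge x to at least e^e. *)
have fin (x : R) : finite_set (close_powers alpha beta x).
  have : expR (expR 1) <= Num.max x (expR (expR 1)) by rewrite le_max lexx orbT.
  move=> /sub_box xb; apply: (@sub_finite_set _ _ _ _ (finite_set_seq _ _)).
  apply: subset_trans xb => -[n m] [n0 m0 nm]; split => //.
  by rewrite le_max nm.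
split => //.
(* Subtracting 1 makes each power at most x/e <= x/2, so their difference is at most x. *)
pose L (x : R) := ln x - 1.
have L_ge (x : R) : expR (1 + a + b) <= x -> a + b <= L x.
  move=> xab; rewrite lerBrDl addrA -[X in X <= _]expRK ler_ln ?posrE ?expR_gt0//.
  by apply: lt_le_trans xab; exact: expR_gt0.
have box_sub (x : R) : expR (1 + a + b) <= x ->
    [set` box (Num.truncn (L x / a)) (Num.truncn (L x / b))]
    `<=` close_powers alpha beta x.
  move=> xab [n m] /=; rewrite mem_box /= => /andP[/andP[n0 nL] /andP[m0 mL]].
  have L0 := L_ge x xab.
  have x0 : 0 < x by apply: lt_le_trans xab; exact: expR_gt0.
  have half (k : nat) (r : R) : 1 < r -> (k <= Num.truncn (L x / ln r))%N -> r ^+ k <= x / 2.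
    move=> r1; have lr0 := ln_gt0 r1.
    rewrite truncn_ge_nat ?divr_ge0 ?(ltW lr0)//; last lra.
    rewrite ler_pdivlMr// => kL.
    rewrite exprn_expR_ln ?(lt_trans ltr01)//.
    apply: (@le_trans _ _ (expR (L x))); first by rewrite ler_expR.
    by rewrite expRB lnK// ler_pM2l// lef_pV2 ?posrE// expR_gt0.
  split => //=; apply: le_trans (le_normcD _ _) _.
  by rewrite normcN !normcX [X in _ <= X]splitr lerD// half.
apply/eqaddOP/bigO_exP.
(* With y = log x and z = log log x, the upper bound (y + D z)^2 exceeds y^2 by at most (2D + D^2) y
   z, and the lower bound (y - 1 - a)(y - 1 - b) falls short by at most (2 + a + b) y z. *)
exists ((2 * D + D ^+ 2 + 2 + a + b) / (a * b)).
  apply: divr_gt0; last exact: mulr_gt0.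
  by have := sqr_ge0 D; lra.
near=> x.
have xe : expR (expR 1) <= x by near: x; apply: nbhs_pinfty_ge; rewrite num_real.
have xab : expR (1 + a + b) <= x by near: x; apply: nbhs_pinfty_ge; rewrite num_real.
have L0 := L_ge x xab; have z1 := lnlnx_ge x xe; have y2 := lnx_ge x xe.
have zy : ln (ln x) <= ln x by apply/ltW/ln_sublinear; lra.
have := card_fset_set_le _ _ _ (sub_box x xe).
have := card_fset_set_ge _ _ _ (fin x) (uniq_box _ _) (box_sub x xab).
rewrite -/(count_close_powers alpha beta x) !size_box -!(ler_nat R) !natrM.
rewrite -[X in `|X|]/((count_close_powers alpha beta x)%:R - ln x ^+ 2 / (a * b)).
set w : R := (count_close_powers _ _ _)%:R => lower upper.
have ab0 := mulr_gt0 a0 b0.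
have {}upper : w * (a * b) <= U x ^+ 2.
  rewrite -ler_pdivlMr//; apply: le_trans upper _.
  have -> : U x ^+ 2 / (a * b) = U x / a * (U x / b) by field; rewrite !gt_eqF.
  by apply: ler_pM => //; rewrite truncn_le divr_ge0 ?U0// ltW.
(* Truncation loses less than 1 per side; L >= a + b keeps both factors nonnegative, so the bounds
   multiply. *)
have {}lower : (L x - a) * (L x - b) <= w * (a * b).
  rewrite -ler_pdivrMr//; apply: le_trans lower.
  have -> : (L x - a) * (L x - b) / (a * b) = (L x / a - 1) * (L x / b - 1).
    by field; rewrite !gt_eqF.
  apply: ler_pM; rewrite ?subr_ge0 ?lerBlDr ?natr1 ?(ltW (truncnS_gt _))//;
    rewrite ler_pdivlMr//; lra.
have lnxz : 0 <= ln x * ln (ln x) by apply: mulr_ge0; lra.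
rewrite (ger0_norm lnxz).
rewrite [X in _ <= X]mulrAC ler_pdivlMr// -{2}(gtr0_norm ab0) -normrM mulrBl divfK ?gt_eqF//.
rewrite ler_norml.
move: lower upper; rewrite /L /U; move: zy z1 y2 L0 e2; rewrite /L.
move: (ln x) (ln (ln x)) => y z zy z1 y2 L0 e2 lower upper.
(* The products needed to make the rest linear: z >= 1 compares y with y z, and z <= y compares z^2
   with y z. *)
have yyz : 0 <= (2 + a + b) * (y * (z - 1)).
  by apply: mulr_ge0; [lra|apply: mulr_ge0; lra].
have Dzy : 0 <= D ^+ 2 * (z * (y - z)).
  by apply: mulr_ge0; [exact: sqr_ge0|apply: mulr_ge0; lra].
have yz0 : 0 <= y * z by apply: mulr_ge0; lra.
have Dyz0 : 0 <= (2 * D + D ^+ 2) * (y * z).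
  by rewrite mulr_ge0// addr_ge0 ?mulr_ge0 ?sqr_ge0.
have abyz0 : 0 <= (2 + a + b) * (y * z) by apply: mulr_ge0 => //; lra.
have ab1 : 0 <= (1 + a) * (1 + b) by apply: mulr_ge0; lra.
apply/andP; split; lra.
Unshelve. all: by end_near.
Qed.
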